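(* Let $M$ be a smooth Poisson manifold, $\mathcal A=C^\infty(M)$ with Poisson bracket $\{\cdot,\cdot\}$, and let $f_1,\dots,f_m\in\mathcal A$ be functionally independent (i.e. $(f_1,\dots,f_m):M\to\mathbb R^m$ is a submersion) with $\{f_i,f_j\}=0$ for all $i,j$. Let $\mathcal C=\mathbb R[f_1,\dots,f_m]\cong\mathbb R[x_1,\dots,x_m]$ be the subalgebra they generate. Let $\ast$ be a star-product on $\mathcal A[[\hbar]]$, let $n\ge2$, and let $D=\mathrm{id}+\hbar D_1+\hbar^2D_2+\dots$ be a formal series of differential operators such that the equivalent star-product $$a\ast'b=D^{-1}(D(a)\ast D(b))=ab+\sum_{k\ge1}\hbar^kB_k(a,b)$$ satisfies $B_1=\dots=B_{n-1}=0$ on $\mathcal C\otimes\mathcal C$. Then the class $\widetilde{B_n}$ of $B_n$ in the second cohomology of $(\wedge^*T^{hor}_\rho M,d^{hor}_\pi)\cong(\mathcal A\otimes\wedge^*\mathbb R^m,d^{hor}_\pi)$ coincides with the Garay–van Straten class $\chi_n$ of the system $f_i^{(n-1)}=D(f_i)$, $i=1,\dots,m$.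
   Context: Local cochains: $CH^k(\mathcal A)$ is the space of $k$-linear maps $\mathcal A^{\otimes k}\to\mathcal A$ that are local on $M$ (the value at $x$ depends only on the arguments in arbitrarily small neighbourhoods of $x$; equivalently, given by polydifferential operators). $CH^k(\mathcal C,\mathcal A)$ is the space of $k$-linear maps $\mathcal C^{\otimes k}\to\mathcal A$ that are restrictions of elements of $CH^k(\mathcal A)$. $H^*(\mathcal C,\mathcal A)$ is its cohomology with respect to the Hochschild differential. Star-product: an $\hbar$-linear ($\hbar$-adically continuous) associative product $a\ast b=ab+\sum_{k\ge1}\hbar^kB_k(a,b)$ on $\mathcal A[[\hbar]]$ with $B_k\in CH^2(\mathcal A)$. The initial product has $B_1=\{\cdot,\cdot\}$, and the paper keeps this normalization for the equivalent products as well. Relative Poisson complex: let $\rho=(f_1,\dots,f_m):M\to\mathbb R^m$, $T^{vert}_\rho M=\ker d\rho$, $T^{hor}_\rho M=TM/T^{vert}_\rho M$, and let $\wedge^*T^{hor}_\rho M$ denote sections of the exterior algebra bundle. With the basis $e_1,\dots,e_m$ of $\mathbb R^m$ corresponding to the classes of (lifts of) $\partial/\partial x_1,\dots,\partial/\partial x_m$, so that $e_i(f_j)=\delta_{ij}$, one has $\wedge^*T^{hor}_\rho M=\mathcal A\otimes\wedge^*\mathbb R^m$. The Hochschild–Kostant–Rosenberg map $w\otimes e_{i_1}\wedge\dots\wedge e_{i_k}\mapsto\big((a_1,\dots,a_k)\mapsto\frac{1}{k!}\sum_{\sigma\in S_k}(-1)^\sigma w\,e_{i_1}(a_{\sigma(1)})\cdots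 e_{i_k}(a_{\sigma(k)})\big)$ identifies it with $H^*(\mathcal C,\mathcal A)$. The differential $d^{hor}_\pi$, induced by the Schouten bracket with the Poisson bivector $\pi$ (apply $[\pi,\cdot]$ to a lift to $\wedge^*TM$ and project to $\wedge^*T^{hor}_\rho M$), is $$d^{hor}_\pi(w\otimes v)=\sum_{i=1}^m\{f_i,w\}\otimes e_i\wedge v,\qquad w\in\mathcal A,\ v\in\wedge^*\mathbb R^m.$$ Class $\widetilde{B_n}$: when $B_1=\dots=B_{n-1}=0$ on $\mathcal C\otimes\mathcal C$, the restriction of $B_n$ to $\mathcal C$ is a Hochschild cocycle. Its class in $H^2(\mathcal C,\mathcal A)=\mathcal A\otimes\wedge^2\mathbb R^m$ is $d^{hor}_\pi$-closed, and $\widetilde{B_n}$ is the resulting class in the cohomology of $d^{hor}_\pi$. Garay–van Straten class $\chi_n$: given series $f_i^{(n-1)}\in\mathcal A[[\hbar]]$ with $f_i^{(n-1)}\equiv f_i\bmod\hbar$ whose $\ast$-commutators $[F,G]=F\ast G-G\ast F$ satisfy $[f_i^{(n-1)},f_j^{(n-1)}]\in\hbar^n\mathcal A[[\hbar]]$ for all $i,j$, $\chi_n$ is the $d^{hor}_\pi$-cohomology class of $$\sum_{i<j}[f_i^{(n-1)},f_j^{(n-1)}]^{(n)}\otimes e_i\wedge e_j\in\mathcal A\otimes\wedge^2\mathbb R^m,$$ where $[\cdot,\cdot]^{(n)}$ denotes the coefficient of $\hbar^n$. *)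

(* Defs.v *)
From HB Require Import structures.
From mathcomp Require Import all_boot all_order all_algebra.
From mathcomp Require Import all_classical all_reals all_analysis.
From mathcomp Require mpoly.

Set Implicit Arguments.
Unset Strict Implicit.
Unset Printing Implicit Defensive.

Import Order.TTheory GRing.Theory Num.Theory.
Import numFieldNormedType.Exports.
Local Open Scope classical_set_scope.
Local Open Scope ring_scope.

Lemma near_continuous (S T : topologicalType) (g h : S -> T) (x : S) :
  (\forall y \near x, g y = h y) ->
  {for x, continuous g} -> {for x, continuous h}.
Proof.
move=> gh cg; suff : h @ x --> g x by rewrite (nbhs_singleton gh).
by apply: cvg_trans cg; exact: near_eq_cvg.
Qed.

Section Euclidean.
Context {R : realType} {d : nat}.
Implicit Types (U : set 'rV[R]_d) (g h : 'rV[R]_d -> R).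

Fixpoint Ck (k : nat) U g : Prop :=
  (forall x, U x -> {for x, continuous g}) /\
  (if k is k'.+1 then
     forall v, (forall x, U x -> derivable g x v) /\ Ck k' U ('D_v g)
   else True).

Definition smooth_on U g : Prop := forall k, Ck k U g.

Lemma CkS k U g : Ck k.+1 U g -> Ck k U g.
Proof.
elim: k g => [|k IH] g [cg dg]; first by split.
by split=> // v; have [dvg Cg] := dg v; split=> //; exact: IH.
Qed.

Lemma eq_Ck k U g h : open U -> (forall x, U x -> g x = h x) ->
  Ck k U g -> Ck k U h.
Proof.
move=> oU; elim: k g h => [|k IH] g h gh [cg dg];
  have near_gh x (Ux : U x) : \forall y \near x, g y = h y
    by apply: filterS (open_nbhs_nbhs (conj oU Ux)); exact: gh.
  by split=> // x Ux; exact: near_continuous (near_gh x Ux) (cg x Ux).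
split=> [x Ux|v]; first exact: near_continuous (near_gh x Ux) (cg x Ux).
have [dvg Cg] := dg v; split=> [x Ux|].
  by apply: near_eq_derivable (dvg _ Ux); exact: near_gh.
by apply: IH Cg => x Ux; apply: near_eq_derive; exact: near_gh.
Qed.

Lemma Ck_cst k U (c : R) : open U -> Ck k U (cst c).
Proof.
move=> oU; elim: k c => [|k IH] c; first by split=> // x _; exact: cst_continuous.
split=> [x _|v]; first exact: cst_continuous.
split=> [x _|]; first exact: derivable_cst.
by apply: eq_Ck (IH 0) => // x _; rewrite derive_cst.
Qed.

Lemma CkD k U g h : open U -> Ck k U g -> Ck k U h -> Ck k U (g + h).
Proof.
move=> oU; elim: k g h => [|k IH] g h [cg dg] [ch dh].
  by split=> // x Ux; exact: continuousD (cg x Ux) (ch x Ux).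
split=> [x Ux|v]; first by exact: continuousD (cg x Ux) (ch x Ux).
have [dvg Cg] := dg v; have [dvh Ch] := dh v.
split=> [x Ux|]; first by apply: derivableD; [exact: dvg|exact: dvh].
apply: eq_Ck (IH _ _ Cg Ch) => // x Ux.
by rewrite deriveD; [|exact: dvg|exact: dvh].
Qed.

Lemma CkM k U g h : open U -> Ck k U g -> Ck k U h -> Ck k U (g * h).
Proof.
move=> oU; elim: k g h => [|k IH] g h Cgk Chk.
  by split=> // x Ux; exact: continuousM (Cgk.1 x Ux) (Chk.1 x Ux).
have [[cg dg] [ch dh]] := (Cgk, Chk).
split=> [x Ux|v]; first by exact: continuousM (cg x Ux) (ch x Ux).
have [dvg Cg] := dg v; have [dvh Ch] := dh v.
split=> [x Ux|]; first by apply: derivableM; [exact: dvg|exact: dvh].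
apply: eq_Ck (CkD oU (IH _ _ (CkS Cgk) Ch) (IH _ _ (CkS Chk) Cg)) => // x Ux.
by rewrite deriveM; [|exact: dvg|exact: dvh].
Qed.

End Euclidean.

Record chart (R : realType) (d : nat) (M : topologicalType) := Chart {
  chart_dom : set M;
  chart_map : M -> 'rV[R]_d;
  chart_inv : 'rV[R]_d -> M;
  open_chart_dom : open chart_dom;
  open_chart_img : open (chart_map @` chart_dom);
  chart_mapK : forall x, chart_dom x -> chart_inv (chart_map x) = x;
  chart_map_continuous :
    forall x, chart_dom x -> {for x, continuous chart_map};
  chart_inv_continuous : forall y, (chart_map @` chart_dom) y ->
    {for y, continuous chart_inv} }.

Definition chart_img (R : realType) d (M : topologicalType) (c : chart R d M) :=
  chart_map c @` chart_dom c.

(* Manifolds are nonempty, since the carrier is pointed; for a submersion this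
   is what makes R[f_1, ..., f_m] a polynomial ring. *)
Record smooth_manifold (R : realType) (d : nat) := SmoothManifold {
  manifold_sort :> ptopologicalType;
  atlas : set (chart R d manifold_sort);
  manifold_hausdorff : hausdorff_space manifold_sort;
  manifold_second_countable : @second_countable manifold_sort;
  atlas_cover : forall x, exists2 c, atlas c & chart_dom c x;
  atlas_compatible : forall c c', atlas c -> atlas c' -> forall i,
    smooth_on (chart_map c @` (chart_dom c `&` chart_dom c'))
      (fun y => chart_map c' (chart_inv c y) 0 i) }.

Section SmoothFunctions.
Context {R : realType} {d : nat} (M : smooth_manifold R d).

Definition smooth (a : M -> R) : Prop :=
  forall c, atlas c -> smooth_on (chart_img c) (a \o chart_inv c).

Definition smooth_pred : {pred M -> R} := fun a => `[< smooth a >].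

Lemma smooth_subring : subring_closed smooth_pred.
Proof.
split=> [|a b|a b].
- by apply/asboolP => c _ k; apply: Ck_cst; exact: open_chart_img.
- move=> /asboolP sa /asboolP sb; apply/asboolP => c Ac k.
  have oc : open (chart_img c) := @open_chart_img _ _ _ c.
  have -> : (a - b) \o chart_inv c =
      (a \o chart_inv c) + cst (-1) * (b \o chart_inv c).
    by apply/funext => y; rewrite [RHS]/= mulN1r.
  exact: CkD oc (sa c Ac k) (CkM oc (Ck_cst k (-1) oc) (sb c Ac k)).
- move=> /asboolP sa /asboolP sb; apply/asboolP => c Ac k.
  exact: CkM (@open_chart_img _ _ _ c) (sa c Ac k) (sb c Ac k).
Qed.

Lemma smooth_submod : submod_closed smooth_pred.
Proof.
have [s1 sB sM] := smooth_subring.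
have s0 : 0 \in smooth_pred by rewrite -(subrr 1) sB.
split=> // k a b sa sb.
have scst : cst k \in smooth_pred.
  by apply/asboolP => c _ n; apply: Ck_cst; exact: open_chart_img.
have -> : k *: a + b = cst k * a - (0 - b).
  by rewrite sub0r opprK; apply/funext.
by rewrite sB ?sM ?sB.
Qed.

HB.instance Definition _ := GRing.isSubringClosed.Build _ smooth_pred smooth_subring.
HB.instance Definition _ := GRing.isSubmodClosed.Build R _ smooth_pred smooth_submod.

Record Cinf := MkCinf { Cinf_fun :> M -> R; _ : Cinf_fun \in smooth_pred }.

HB.instance Definition _ := [isSub for Cinf_fun].
HB.instance Definition _ := [Choice of Cinf by <:].
HB.instance Definition _ := [SubChoice_isSubComNzRing of Cinf by <:].
HB.instance Definition _ := [SubZmodule_isSubLmodule of Cinf by <:].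

Lemma Cinf_scaleAl (k : R) (a b : Cinf) : k *: (a * b) = k *: a * b.
Proof. by apply/val_inj/funext => x /=; exact: mulrA. Qed.

HB.instance Definition _ := GRing.Lmodule_isLalgebra.Build R Cinf Cinf_scaleAl.
HB.instance Definition _ := GRing.Lalgebra_isComAlgebra.Build R Cinf.

End SmoothFunctions.

Section Deformation.
Context {R : realType} {d : nat} {M : smooth_manifold R d}.
Local Notation A := (Cinf M).
Implicit Types (a b c : A) (F G : nat -> A).

Definition bilinear2 (B : A -> A -> A) : Prop :=
  (forall a, linear (B a)) /\ (forall b, linear (B^~ b)).

Record poisson_bracket (br : A -> A -> A) : Prop := PoissonBracket {
  poisson_bilinear : bilinear2 br;
  poisson_antisym : forall a b, br a b = - br b a;
  poisson_jacobi : forall a b c,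
    br a (br b c) + br b (br c a) + br c (br a b) = 0;
  poisson_leibniz : forall a b c, br a (b * c) = br a b * c + b * br a c }.

(* CH^1(A) and CH^2(A): by Peetre's theorem the local multilinear maps are the
   polydifferential operators (of locally finite order). *)
Definition CH1 (D : A -> A) : Prop :=
  linear D /\
  forall (x : M) a b, (\forall y \near x, a y = b y) -> D a x = D b x.

Definition CH2 (B : A -> A -> A) : Prop :=
  bilinear2 B /\
  forall (x : M) a a' b b', (\forall y \near x, a y = a' y) ->
    (\forall y \near x, b y = b' y) -> B a b x = B a' b' x.

(* A[[h]] is nat -> A, with F k the coefficient of h^k. *)
Definition series_cst a : nat -> A := fun k => if k == 0%N then a else 0.

Definition star (B : nat -> A -> A -> A) F G : nat -> A := fun n =>
  \sum_(i < n.+1) \sum_(j < (n - i).+1) B i (F j) (G (n - i - j)%N).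

Definition star_comm B F G : nat -> A := fun n => star B F G n - star B G F n.

Record star_product (B : nat -> A -> A -> A) : Prop := StarProduct {
  star_B0 : forall a b, B 0%N a b = a * b;
  star_local : forall k, CH2 (B k);
  star_assoc : forall F G H,
    star B (star B F G) H = star B F (star B G H) }.

Definition series_op (D : nat -> A -> A) F : nat -> A := fun n =>
  \sum_(i < n.+1) D i (F (n - i)%N).

Definition formal_diffop (D : nat -> A -> A) : Prop :=
  (forall a, D 0%N a = a) /\ (forall k, CH1 (D k)).

(* D^-1 = \sum_j (1 - D)^j; since D = 1 mod h, only the terms j <= n contribute
   to the coefficient of h^n. *)
Definition series_op_inv (D : nat -> A -> A) F : nat -> A := fun n =>
  \sum_(j < n.+1) iter j (fun G k => G k - series_op D G k) F n.

Definition equivalent_star (D : nat -> A -> A) (B : nat -> A -> A -> A) :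
    nat -> A -> A -> A := fun k a b =>
  series_op_inv D (star B (series_op D (series_cst a))
                          (series_op D (series_cst b))) k.

Section Commuting.
Context {m : nat} (f : 'I_m -> A).

Definition submersion : Prop :=
  forall (c : chart R d M) (x : M), atlas c -> chart_dom c x ->
  forall w : 'rV[R]_m, exists v : 'rV[R]_d, forall i,
    'D_v (f i \o chart_inv c) (chart_map c x) = w 0 i.

(* p(f_1, ..., f_m), for p in R[x_1, ..., x_m] *)
Definition peval (p : mpoly.mpoly m R) : A :=
  mpoly.mmap (fun k : R => k%:A) f p.

(* membership in C = R[f_1, ..., f_m] *)
Definition inC a : Prop := exists p, a = peval p.

Definition hochschild_d1 (phi : A -> A) a b : A :=
  a * phi b - phi (a * b) + phi a * b.

Definition hochschild_d2 (B : A -> A -> A) a b c : A :=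
  a * B b c - B (a * b) c + B a (b * c) - B a b * c.

(* A (x) wedge^* R^m: omega S is the coefficient of the exterior product, in
   increasing order, of the e_i for i in S. *)
Definition hforms := {ffun {set 'I_m} -> A}.

Definition hdegree (k : nat) (omega : hforms) : Prop :=
  forall S : {set 'I_m}, #|S| != k -> omega S = 0.

Definition hscalar a : hforms :=
  [ffun S : {set 'I_m} => if S == finset.set0 then a else 0].

(* the exterior product e_i /\ omega *)
Definition hwedge (i : 'I_m) (omega : hforms) : hforms :=
  [ffun S : {set 'I_m} => if i \in S then
     (-1) ^+ #|[set j in S | (j < i)%N]%SET| * omega (S :\ i)%SET else 0].

Definition d_hor (br : A -> A -> A) (omega : hforms) : hforms :=
  \sum_(i < m) hwedge i [ffun S => br (f i) (omega S)].

(* same class in the degree 2 cohomology of d_hor *)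
Definition hcohomologous2 br (omega omega' : hforms) : Prop :=
  [/\ d_hor br omega = 0, d_hor br omega' = 0 &
      exists2 eta, hdegree 1 eta & omega - omega' = d_hor br eta].

(* The Hochschild-Kostant-Rosenberg cochain of omega in degree 2, at the pair
   (p(f), q(f)); there e_i(p(f)) is the partial derivative (d_i p)(f). *)
Definition hkr2 (omega : hforms) (p q : mpoly.mpoly m R) : A :=
  \sum_(i < m) \sum_(j < m | (i < j)%N)
    2^-1 *: (omega [set i; j]%SET *
      (peval (mpoly.mderiv i p) * peval (mpoly.mderiv j q) -
       peval (mpoly.mderiv i q) * peval (mpoly.mderiv j p))).

(* omega corresponds, under HKR, to the class in H^2(C, A) of the restriction
   of B to C. A 1-cochain on C is given by an element of CH^1(A) restricting
   to it. *)
Definition hkr_class2 (B : A -> A -> A) (omega : hforms) : Prop :=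
  hdegree 2 omega /\ exists2 phi, CH1 phi & forall p q,
    B (peval p) (peval q) =
      hkr2 omega p q + hochschild_d1 phi (peval p) (peval q).

(* F_i = f_i mod h and [F_i, F_j] = 0 mod h^n *)
Definition commuting_lift B (n : nat) (F : 'I_m -> nat -> A) : Prop :=
  (forall i, F i 0%N = f i) /\
  (forall i j k, (k < n)%N -> star_comm B (F i) (F j) k = 0).

(* the cochain whose class is the Garay-van Straten class chi_n *)
Definition gvs_cochain B (n : nat) (F : 'I_m -> nat -> A) : hforms :=
  \sum_(i < m) \sum_(j < m | (i < j)%N)
    hwedge i (hwedge j (hscalar (star_comm B (F i) (F j) n))).

End Commuting.
End Deformation.

(* Main.v *)
From HB Require Import structures.
Require Import Defs.
From mathcomp Require Import all_boot all_order all_algebra.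
From mathcomp Require Import all_classical all_reals all_analysis.
From mathcomp Require mpoly.
Import (canonicals) mpoly.
From mathcomp Require Import zify ring.
Import Order.TTheory GRing.Theory Num.Theory.
Local Open Scope ring_scope.

(** Write [*'] for the product transported by [D], so that
    [D a * D b = D (a *' b)] ([star_series_op]). On the subalgebra generated
    by the [f_i] the cochains of [*'] of orders [1, ..., n-1] vanish, hence
    [[
      D a * D b = D (a b) + h^n B'_n (a, b) + O(h^(n+1))
    ]]
    there ([star_series_op_jet]), because [D] is the identity modulo [h]. Three
    consequences of this expansion give the theorem.

    - Expanding [(D a * D b) * D c = D a * (D b * D c)] at order [h^n] says that
      [B'_n] is a Hochschild cocycle on the subalgebra
      ([equivalent_star_cocycle]).
    - With [F_i = D f_i], the commutator [[F_i, F_j]] is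
      [h^n (B'_n (f_i, f_j) - B'_n (f_j, f_i)) + O(h^(n+1))]
      ([star_comm_series_op]): the symmetric leading term [D (f_i f_j)] drops
      out. So the [F_i] commute modulo [h^n], and the coefficients [chi_ij] of
      the Garay-van Straten cochain are the antisymmetrisation of [B'_n] on the
      generators.
    - The Jacobi identity for [F_i], [F_j], [F_k], read at order [h^(n+1)], is
      twice the cyclic sum of the [{f_i, chi_jk}], since [B_1] is the bracket
      ([star_comm_coef_order1]); and that cyclic sum is the coefficient of
      [e_i /\ e_j /\ e_k] in the differential of the cochain
      ([d_hor_gvs_cochain]).

    For the comparison of classes, suppose that [omega] represents [B'_n] under
    the Hochschild-Kostant-Rosenberg map, up to a Hochschild coboundary. Over a
    commutative algebra the coboundary of a 1-cochain is symmetric, so it is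
    killed by antisymmetrisation, whereas the HKR cochain of [omega] takes the
    values [omega_ij / 2] and [- omega_ij / 2] at [(f_i, f_j)] and [(f_j, f_i)].
    Hence [omega_ij = chi_ij] ([hkr_class2_commutator]): the two cochains are
    equal, and a fortiori cohomologous, with primitive [0]. *)

(** * Formal series and star products *)

Section FormalSeries.
Context {R : realType} {d : nat} {M : smooth_manifold R d}.
Local Notation A := (Cinf M).
Implicit Types (a b c : A) (F G H X Y Z : nat -> A).
Implicit Types (B : nat -> A -> A -> A) (D : nat -> A -> A).

Definition divisible_by_power (n : nat) X : Prop :=
  forall k, (k < n)%N -> X k = 0.

Definition biadditive (P : A -> A -> A) : Prop :=
  (forall a, zmod_morphism (P a)) /\ (forall b, zmod_morphism (P^~ b)).

Lemma bilinear2_biadditive P : bilinear2 P -> biadditive P.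
Proof.
by case=> l r; split=> a; apply: zmod_morphism_linear; [exact: l|exact: r].
Qed.

Lemma zmod_morphism0 (U V : zmodType) (g : U -> V) : zmod_morphism g -> g 0 = 0.
Proof. by move=> gB; rewrite -(subrr 0) gB subrr. Qed.

Definition opp_star B : nat -> A -> A -> A := fun k a b => B k b a.

Lemma opp_star_biadditive B :
  (forall k, biadditive (B k)) -> forall k, biadditive (opp_star B k).
Proof. by move=> Badd k; have [? ?] := Badd k. Qed.

(** Transposing the product lets every expansion in the right argument serve
    for the left argument as well. *)
Lemma star_opp B F G : star B F G = star (opp_star B) G F.
Proof.
apply/funext => n; apply: eq_bigr => i _.
rewrite (reindex_inj rev_ord_inj) /=; apply: eq_bigr => j _.
have jn : (j <= n - i)%N by rewrite -ltnS.
by rewrite subSS subKn.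
Qed.

Lemma starBl B F G H : (forall k, biadditive (B k)) ->
  star B (F - G) H = star B F H - star B G H.
Proof.
move=> Badd; apply/funext => n.
transitivity (star B F H n - star B G H n) => //.
rewrite /star -sumrB; apply: eq_bigr => i _.
by rewrite -sumrB; apply: eq_bigr => j _; rewrite ((Badd _).2 _).
Qed.

Lemma starBr B F G H : (forall k, biadditive (B k)) ->
  star B H (F - G) = star B H F - star B H G.
Proof.
by move=> Badd; rewrite !(star_opp B H) starBl//; exact: opp_star_biadditive.
Qed.

(** If [X = O(h^n)], the term [B_i (F_j) (X_k)] of order [h^n] needs [k >= n],
    which leaves only [i = j = 0]. *)
Lemma star_coef_order0 B n F X : (forall k, biadditive (B k)) ->
  divisible_by_power n X -> star B F X n = B 0%N (F 0%N) (X n).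
Proof.
move=> Badd X0; rewrite /star big_ord_recl big_ord_recl /= !subn0.
rewrite big1 => [|j _].
  rewrite addr0 big1 ?addr0// => i _; rewrite big1// => j _.
  rewrite X0 ?(zmod_morphism0 _ _ _ ((Badd _).1 _))//.
  have := ltn_ord j; have := ltn_ord i; rewrite /= /bump /=; lia.
rewrite X0 ?(zmod_morphism0 _ _ _ ((Badd _).1 _))//.
have := ltn_ord j; rewrite /= /bump /=; lia.
Qed.

(** One order further, [i + j <= 1] leaves the three terms [(i, j) = (0, 0)],
    [(0, 1)] and [(1, 0)]. *)
Lemma star_coef_order1 B n F X : (forall k, biadditive (B k)) ->
  divisible_by_power n X ->
  star B F X n.+1 = B 0%N (F 0%N) (X n.+1) + B 0%N (F 1%N) (X n)
                    + B 1%N (F 0%N) (X n).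
Proof.
move=> Badd X0.
have B_X0 i a k : (k < n)%N -> B i a (X k) = 0.
  by move=> kn; rewrite X0 ?(zmod_morphism0 _ _ _ ((Badd _).1 _)).
rewrite /star 2!big_ord_recl /= subn0 [X in _ + (_ + X)]big1 ?addr0; last first.
  move=> i _; rewrite big1// => j _; apply: B_X0.
  have := ltn_ord j; have := ltn_ord i; rewrite /= /bump /=; lia.
congr (_ + _).
  rewrite 2!big_ord_recl /= !subn0 subSS subn0 big1 ?addr0// => j _.
  by apply: B_X0; have := ltn_ord j; rewrite /= /bump /=; lia.
rewrite big_ord_recl /= !subn0 subSS subn0 big1 ?addr0// => j _.
by apply: B_X0; have := ltn_ord j; rewrite /= /bump /=; lia.
Qed.

(** The terms with [B 0] are commutative and cancel; only the infinitesimal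
    part [B 1] of the deformation is seen. *)
Lemma star_comm_coef_order1 B n F X : (forall k, biadditive (B k)) ->
  (forall a b, B 0%N a b = a * b) ->
  divisible_by_power n X ->
  star_comm B F X n.+1 = B 1%N (F 0%N) (X n) - B 1%N (X n) (F 0%N).
Proof.
move=> Badd B0 X0; rewrite /star_comm (star_opp B X F).
rewrite !star_coef_order1//; last exact: opp_star_biadditive.
rewrite /opp_star !B0 (mulrC (X n.+1)) (mulrC (X n)).
by rewrite opprD addrACA subrr add0r.
Qed.

Lemma star_comm_jacobi B F G H : (forall k, biadditive (B k)) ->
  (forall F G H, star B (star B F G) H = star B F (star B G H)) ->
  star_comm B F (star_comm B G H) + star_comm B G (star_comm B H F)
  + star_comm B H (star_comm B F G) = 0.
Proof.
move=> Badd Bassoc.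
(* after reassociation only the six products x * (y * z) remain *)
have E X Y Z : star_comm B X (star_comm B Y Z) =
    star B X (star B Y Z) - star B X (star B Z Y)
    - (star B Y (star B Z X) - star B Z (star B Y X)).
  rewrite [LHS]/(star B X (star B Y Z - star B Z Y)
                 - star B (star B Y Z - star B Z Y) X).
  by rewrite starBl// starBr// !Bassoc.
rewrite !E.
move: (star B F (star B G H)) (star B F (star B H G)) (star B G (star B H F))
  (star B G (star B F H)) (star B H (star B F G)) (star B H (star B G F)).
move=> x1 x2 x3 x4 x5 x6.
apply/funext => k; rewrite !fctE; rewrite [RHS](_ : _ = 0)//; ring.
Qed.

Lemma series_opB D F G : (forall k, CH1 (D k)) ->
  series_op D (F - G) = series_op D F - series_op D G.
Proof.
move=> Dlin; apply/funext => n.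
transitivity (series_op D F n - series_op D G n) => //.
rewrite /series_op -sumrB; apply: eq_bigr => i _.
by rewrite (zmod_morphism_linear (Dlin _).1).
Qed.

(** A series of operators that starts with the identity is filtered, and acts
    as the identity on leading terms. *)
Lemma series_op_divisible D n X : formal_diffop D -> divisible_by_power n X ->
  divisible_by_power n (series_op D X) /\ series_op D X n = X n.
Proof.
move=> [D0 Dlin] X0.
have DX0 i k : (k < n)%N -> D i (X k) = 0.
  by move=> kn; rewrite X0// (zmod_morphism0 _ _ _ (zmod_morphism_linear (Dlin _).1)).
split=> [k kn|].
  by rewrite /series_op big1// => i _; apply: DX0; lia.
rewrite /series_op big_ord_recl subn0 D0 big1 ?addr0// => i _.
by apply: DX0; have := ltn_ord i; rewrite /= /bump /=; lia.
Qed.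

Lemma series_op_inv_coef0 D F : series_op_inv D F 0%N = F 0%N.
Proof. by rewrite /series_op_inv big_ord1. Qed.

(** With [E = 1 - D], which raises the order in [h], [D] times the partial sum
    [1 + E + ... + E^n] telescopes to [1 - E^(n+1)], and this is the identity
    up to order [h^n]. *)
Lemma series_opK D F : formal_diffop D -> series_op D (series_op_inv D F) = F.
Proof.
move=> Dop; have [D0 Dlin] := Dop.
pose E G := G - series_op D G.
have EB G H : E (G - H) = E G - E H.
  by rewrite /E series_opB//; apply/funext => k; rewrite !fctE; ring.
have Ediv n X : divisible_by_power n X -> divisible_by_power n.+1 (E X).
  move=> X0; have [DX0 DXn] := series_op_divisible _ _ _ Dop X0.
  move=> k; rewrite ltnS leq_eqVlt => /predU1P[->|kn].
    by rewrite /E !fctE DXn subrr.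
  by rewrite /E !fctE X0// DX0// subr0.
have iterE j : divisible_by_power j (iter j E F).
  by elim: j => [|j IHj] //=; exact: Ediv.
apply/funext => n.
pose S := \sum_(j < n.+1) iter j E F.
(* the truncation of the Neumann series may be taken independent of k <= n *)
have SE k : (k <= n)%N -> series_op_inv D F k = S k.
  move=> kn; rewrite /S fct_sumE.
  transitivity (\sum_(j < n.+1 | (j < k.+1)%N) iter j E F k).
    by rewrite -(big_ord_widen n.+1 (fun j => iter j E F k)).
  rewrite big_mkcond /=; apply: eq_bigr => j _; case: ltnP => // kj.
  by rewrite iterE.
transitivity (series_op D S n).
  by apply: eq_bigr => i _; rewrite SE// leq_subr.
have DE G : series_op D G = G - E G by rewrite /E subKr.
have E0 : zmod_morphism E by exact: EB.
pose Ea : {additive _ -> _} := HB.pack E (GRing.isZmodMorphism.Build _ _ E E0).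
have -> : series_op D S = \sum_(j < n.+1) (iter j E F - iter j.+1 E F).
  by rewrite DE /S -[E _]/(Ea _) raddf_sum -sumrB.
have -> : \sum_(j < n.+1) (iter j E F - iter j.+1 E F) = F - iter n.+1 E F.
  rewrite -(big_mkord xpredT (fun j => iter j E F - iter j.+1 E F)).
  rewrite (telescope_sumr_eq (fun j => - iter j E F))// => [|j _].
    by rewrite opprK addrC.
  by rewrite opprK addrC.
by rewrite !fctE iterE// subr0.
Qed.
Lemma star_series_op B D a b : formal_diffop D ->
  star B (series_op D (series_cst a)) (series_op D (series_cst b)) =
  series_op D (fun k => equivalent_star D B k a b).
Proof. by move=> Dop; rewrite -[LHS](series_opK D)//. Qed.

Lemma equivalent_star0 B D a b :
  (forall a b, B 0%N a b = a * b) -> formal_diffop D ->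
  equivalent_star D B 0%N a b = a * b.
Proof.
move=> B0 [D0 _]; rewrite /equivalent_star series_op_inv_coef0.
by rewrite /star big_ord1 big_ord1 B0 /series_op !big_ord1 !D0.
Qed.

(** The expansion [D a * D b = D (a b) + h^n B'_n (a, b) + O(h^(n+1))]. The
    error term [Z] is [D] applied to [a *' b - a b], which starts at order
    [h^n], so [D] does not change its leading term. *)
Lemma star_series_op_jet B D n a b :
  (forall a b, B 0%N a b = a * b) -> formal_diffop D -> (0 < n)%N ->
  (forall k, (0 < k < n)%N -> equivalent_star D B k a b = 0) ->
  exists Z, [/\ divisible_by_power n Z, Z n = equivalent_star D B n a b &
    star B (series_op D (series_cst a)) (series_op D (series_cst b)) =
    series_op D (series_cst (a * b)) + Z].
Proof.
move=> B0 Dop n_gt0 van; pose P := fun k => equivalent_star D B k a b.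
have X0 : divisible_by_power n (P - series_cst (a * b)).
  move=> [|k] kn; rewrite !fctE /P /series_cst.
    by rewrite eqxx equivalent_star0// subrr.
  by rewrite subr0 van.
have [DX0 DXn] := series_op_divisible _ _ _ Dop X0.
exists (series_op D (P - series_cst (a * b))); split=> //.
  by rewrite DXn !fctE /series_cst eqn0Ngt n_gt0 subr0.
by rewrite (series_opB _ _ _ Dop.2) addrC subrK; exact: star_series_op.
Qed.

Lemma starDl B F G H : (forall k, biadditive (B k)) ->
  star B (F + G) H = star B F H + star B G H.
Proof. by move=> Badd; rewrite -{2}(addrK G F) starBl// subrK. Qed.

Lemma starDr B F G H : (forall k, biadditive (B k)) ->
  star B H (F + G) = star B H F + star B H G.
Proof. by move=> Badd; rewrite -{2}(addrK G F) starBr// subrK. Qed.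

(** [(D a * D b) * D c] is [D (a b) * D c + Z * D c] with
    [Z = h^n B'_n (a, b) + O(h^(n+1))]; as [a b] lies in [C] again, the first
    summand expands to [D (a b c) + h^n B'_n (a b, c)]. Together with the
    mirror computation, associativity at order [h^n] is the cocycle identity. *)
Lemma equivalent_star_cocycle (C : A -> Prop) B D n :
  (forall k, biadditive (B k)) -> (forall a b, B 0%N a b = a * b) ->
  (forall F G H, star B (star B F G) H = star B F (star B G H)) ->
  formal_diffop D -> (0 < n)%N -> (forall a b, C a -> C b -> C (a * b)) ->
  (forall k, (0 < k < n)%N -> forall a b, C a -> C b ->
    equivalent_star D B k a b = 0) ->
  forall a b c, C a -> C b -> C c ->
    hochschild_d2 (equivalent_star D B n) a b c = 0.
Proof.
move=> Badd B0 Bassoc Dop n_gt0 CM van a b c Ca Cb Cc.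
have jet x y (Cx : C x) (Cy : C y) :=
  star_series_op_jet B D n x y B0 Dop n_gt0 (fun k kn => van k kn x y Cx Cy).
have [Zab [Zab0 Zabn Eab]] := jet a b Ca Cb.
have [Zbc [Zbc0 Zbcn Ebc]] := jet b c Cb Cc.
have [Zl [_ Zln El]] := jet (a * b) c (CM _ _ Ca Cb) Cc.
have [Zr [_ Zrn Er]] := jet a (b * c) Ca (CM _ _ Cb Cc).
have D_coef0 x : series_op D (series_cst x) 0%N = x.
  by rewrite /series_op big_ord1 Dop.1.
have := congr1 (fun F => F n) (Bassoc (series_op D (series_cst a))
  (series_op D (series_cst b)) (series_op D (series_cst c))).
rewrite Eab Ebc starDl// starDr// El Er mulrA !fctE (star_opp B Zab).
rewrite !star_coef_order0//; last exact: opp_star_biadditive.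
rewrite /opp_star !D_coef0 !B0 Zabn Zbcn Zln Zrn -!addrA => /addrI E.
by rewrite /hochschild_d2 addrAC -[X in X + _]addrA -opprD E addrAC [X in X - _]addrC subrr.
Qed.

(** The expansions of [D a * D b] and [D b * D a] have the same leading part
    [D (a b)]. *)
Lemma star_comm_series_op B D n a b :
  (forall a b, B 0%N a b = a * b) -> formal_diffop D -> (0 < n)%N ->
  (forall k, (0 < k < n)%N ->
    equivalent_star D B k a b = 0 /\ equivalent_star D B k b a = 0) ->
  let C := star_comm B (series_op D (series_cst a)) (series_op D (series_cst b)) in
  divisible_by_power n C /\
  C n = equivalent_star D B n a b - equivalent_star D B n b a.
Proof.
move=> B0 Dop n_gt0 van C.
have [Z [Z0 Zn E]] := star_series_op_jet B D n a b B0 Dop n_gt0 (fun k kn => (van k kn).1).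
have [Z' [Z'0 Z'n E']] := star_series_op_jet B D n b a B0 Dop n_gt0 (fun k kn => (van k kn).2).
have CE k : C k = Z k - Z' k.
  by rewrite /C /star_comm E E' (mulrC b) !fctE opprD addrACA subrr add0r.
split=> [k kn|]; first by rewrite CE Z0 ?Z'0 ?subrr.
by rewrite CE Zn Z'n.
Qed.
End FormalSeries.

(** * The relative Poisson complex *)

Section RelativePoissonComplex.
Context {R : realType} {d : nat} {M : smooth_manifold R d} {m : nat}.
Local Notation A := (Cinf M).
Local Notation forms := (@hforms R d M m).
Implicit Types (omega : forms) (i j k : 'I_m) (S : {set 'I_m}).

Lemma hwedge_zmod_morphism i : zmod_morphism (hwedge i : forms -> forms).
Proof.
move=> om om'; apply/ffunP => S; rewrite !ffunE.
by case: ifP => _; rewrite ?subr0// mulrBr.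
Qed.

HB.instance Definition _ i := GRing.isZmodMorphism.Build forms forms
  (hwedge i) (hwedge_zmod_morphism i).

Lemma hscalar_zmod_morphism : zmod_morphism (hscalar : A -> forms).
Proof.
by move=> x y; apply/ffunP => S; rewrite !ffunE; case: ifP; rewrite ?subr0.
Qed.

HB.instance Definition _ := GRing.isZmodMorphism.Build A forms
  hscalar hscalar_zmod_morphism.

Lemma hwedge_anticomm i j omega :
  hwedge i (hwedge j omega) = - hwedge j (hwedge i omega).
Proof.
apply/ffunP => S; rewrite !ffunE !in_setD1 (eq_sym j i).
have [->|neq_ij] := eqVneq i j; first by rewrite /= mulr0 if_same oppr0.
have [iS|] /= := boolP (i \in S); have [jS|] //= := boolP (j \in S);
  rewrite ?mulr0 ?oppr0//.
(* pos k S is the number of transpositions that move e_k into its place in S;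
   removing a smaller index lowers it by one, whence the sign *)
pose pos k S := #|[set l in S | (l < k)%N]%SET|.
have posD1 k l : k \in S -> pos l S = ((k < l)%N + pos l (S :\ k)%SET)%N.
  move=> kS; rewrite /pos (cardsD1 k) !inE kS /=; congr (_ + #|pred_of_set _|)%N.
  by apply/setP => z; rewrite !inE andbA.
rewrite -!/(pos _ _) (posD1 j i)// (posD1 i j)// !finset.setDDl (finset.setUC [set j]%SET).
rewrite !exprD !mulrA -!mulNr; congr (_ * _).
move: neq_ij; rewrite -val_eqE neq_ltn.
by case: ltngtP => //= _ _; rewrite !(expr0, expr1, mul1r, mulNr, opprK) mulrC.
Qed.

Lemma hwedge3_cyclic i j k omega :
  hwedge j (hwedge k (hwedge i omega)) = hwedge i (hwedge j (hwedge k omega)).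
Proof.
by rewrite (hwedge_anticomm k i) raddfN /= hwedge_anticomm opprK.
Qed.

(** The 2-form [\sum_(i < j) chi_ij e_i /\ e_j]; [gvs_cochain] is this form for
    the coefficients of the commutators. *)
Definition hform2 (chi : 'I_m -> 'I_m -> A) : forms :=
  \sum_(i < m) \sum_(j < m | (i < j)%N) hwedge i (hwedge j (hscalar (chi i j))).

Lemma mulrn_Cinf_eq0 (x : A) n : x *+ n.+1 = 0 -> x = 0.
Proof.
by rewrite -scaler_nat => /eqP; rewrite scaler_eq0 pnatr_eq0 /= => /eqP.
Qed.

Lemma mulrn_hforms_eq0 omega n : omega *+ n.+1 = 0 -> omega = 0.
Proof.
move=> /ffunP om0; apply/ffunP => S; rewrite ffunE; apply: (mulrn_Cinf_eq0 _ n).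
by have := om0 S; rewrite ffunMnE ffunE.
Qed.

(** Passing from increasing pairs to all pairs of indices costs a factor 2 and
    makes the summand accessible to free reindexing. *)
Lemma sum_sym_offdiag (V : zmodType) (w : 'I_m -> 'I_m -> V) :
  (forall i j, w i j = w j i) -> (forall i, w i i = 0) ->
  \sum_(i < m) \sum_(j < m) w i j =
  (\sum_(i < m) \sum_(j < m | (i < j)%N) w i j) *+ 2.
Proof.
move=> wC w0; rewrite mulr2n.
under eq_bigr => i _ do rewrite (bigID (fun j : 'I_m => (i < j)%N)) /=.
rewrite big_split /=; congr (_ + _).
rewrite (exchange_big_dep xpredT) //=; apply: eq_bigr => j _.
rewrite [RHS]big_mkcond [LHS]big_mkcond /=; apply: eq_bigr => i _.
by rewrite -leqNgt; case: ltngtP => // /val_inj ->.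
Qed.

(** Up to a factor 2, the differential is the sum over all [(i, j, k)] of
    [{f_i, chi_jk} e_i /\ e_j /\ e_k]. Averaging over cyclic permutations of
    the indices leaves the exterior product invariant and replaces the
    coefficient by the cyclic sum, which vanishes. The factors 2 and 3 are
    invertible. *)
Lemma d_hor_hform2 (f : 'I_m -> A) (br : A -> A -> A)
    (chi : 'I_m -> 'I_m -> A) :
  (forall a, zmod_morphism (br a)) ->
  (forall i j, chi i j = - chi j i) ->
  (forall i j k, br (f i) (chi j k) + br (f j) (chi k i) + br (f k) (chi i j) = 0) ->
  d_hor f br (hform2 chi) = 0.
Proof.
move=> brB chiN chiJ.
have chi0 i : chi i i = 0.
  apply: (mulrn_Cinf_eq0 _ 1); rewrite mulr2n {1}chiN addrC subrr//.
have brN a x : br a (- x) = - br a x.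
  by rewrite -[- x]sub0r brB (zmod_morphism0 _ _ _ (brB a)) sub0r.
pose T i j k : forms := hwedge i (hwedge j (hwedge k (hscalar (br (f i) (chi j k))))).
pose L (a : A) omega : forms := [ffun S => br a (omega S)].
have LB a : zmod_morphism (L a).
  by move=> om om'; apply/ffunP => S; rewrite !ffunE brB.
(* L a is the action of br a on coefficients *)
pose La (a : A) : {additive _ -> _} :=
  HB.pack (L a) (GRing.isZmodMorphism.Build _ _ (L a) (LB a)).
have Lw a i om : L a (hwedge i om) = hwedge i (L a om).
  apply/ffunP => S; rewrite !ffunE; case: ifP => _.
    by rewrite -signr_odd !mulr_sign; case: ifP.
  exact: zmod_morphism0.
have Ls a x : L a (hscalar x) = hscalar (br a x).
  by apply/ffunP => S; rewrite !ffunE; case: ifP => // _; exact: zmod_morphism0.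
have dE : d_hor f br (hform2 chi) =
    \sum_(i < m) \sum_(j < m) \sum_(k < m | (j < k)%N) T i j k.
  apply: eq_bigr => i _; rewrite -[finfun _]/(La (f i) _) /hform2.
  rewrite raddf_sum raddf_sum; apply: eq_bigr => j _.
  rewrite raddf_sum raddf_sum; apply: eq_bigr => k _.
  by rewrite [La _ _]Lw Lw Ls.
apply: (mulrn_hforms_eq0 _ 1); apply: (mulrn_hforms_eq0 _ 2).
have -> : d_hor f br (hform2 chi) *+ 2 = \sum_i \sum_j \sum_k T i j k.
  rewrite dE -sumrMnl; apply: eq_bigr => i _; rewrite -sum_sym_offdiag //.
    by move=> j k; rewrite /T chiN brN !raddfN /= (hwedge_anticomm j k) raddfN /= opprK.
  by move=> j; rewrite /T chi0 (zmod_morphism0 _ _ _ (brB _)) !raddf0.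
have cyc (w : 'I_m -> 'I_m -> 'I_m -> forms) :
    \sum_i \sum_j \sum_k w i j k = \sum_i \sum_j \sum_k w j k i.
  by rewrite [RHS]exchange_big; apply: eq_bigr => j _; rewrite [RHS]exchange_big.
rewrite 2!mulrS mulr1n {2 3}(cyc T) {2}(cyc (fun i j k => T j k i)) -!big_split /= big1 // => i _.
rewrite -!big_split /= big1 // => j _; rewrite -!big_split /= big1 // => k _.
rewrite /T (hwedge3_cyclic i) -(hwedge3_cyclic k) -!raddfD/=.
by rewrite addrA chiJ !raddf0.
Qed.

(** With [i < j] the indices are already in increasing order, so no sign
    appears. *)
Lemma hwedge_hwedge_hscalar i j (x : A) S : (i < j)%N ->
  hwedge i (hwedge j (hscalar x)) S = if S == [set i; j]%SET then x else 0.
Proof.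
move=> ij; rewrite !ffunE in_setD1.
have ji : j != i by rewrite -val_eqE neq_ltn ij orbT.
have [->|neqS] := eqVneq S [set i; j]%SET.
  rewrite !inE !eqxx ji orbT /=.
  have -> : ([set i; j] :\ i :\ j == finset.set0)%SET.
    by apply/eqP/setP => z; rewrite !inE; case: eqP => // _; case: eqP.
  rewrite (eq_card0 (A := [set k in [set i; j] | (k < i)%N]%SET)) => [|z].
    rewrite (eq_card0 (A := [set k in [set i; j] :\ i | (k < j)%N]%SET)) => [|z].
      by rewrite expr0 !mul1r.
    rewrite !inE; case: eqVneq => //= _; case: eqP => // ->.
    by rewrite ltnn.
  rewrite !inE; case: eqP => [->|_] /=; first by rewrite ltnn.
  by case: eqP => // ->; rewrite ltnNge ltnW.
case: ifP => // iS; case: ifP => /= [/andP[_ jS]|_]; last by rewrite mulr0.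
case: ifP; rewrite ?mulr0// => /eqP/setP S0; case/eqP: neqS; apply/setP => z.
rewrite !inE; have := S0 z; rewrite !inE.
case: eqP => [->|_] /=; first by rewrite jS orbT.
by rewrite orbF; case: eqP => [->|].
Qed.

Lemma hdegree2_hform2 chi : hdegree 2 (hform2 chi).
Proof.
move=> S S2; rewrite /hform2 sum_ffunE big1// => i _.
rewrite sum_ffunE big1// => j ij; rewrite hwedge_hwedge_hscalar//.
case: eqP => // SE; move: S2; rewrite SE cards2.
suff -> : i != j by [].
by rewrite -val_eqE neq_ltn ij.
Qed.

Lemma set2_ltn_inj (i j k l : 'I_m) : (i < j)%N -> (k < l)%N ->
  [set i; j]%SET = [set k; l]%SET -> i = k /\ j = l.
Proof.
move=> ij kl E; have := set21 i j; have := set22 i j.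
rewrite E !inE => /orP[]/eqP jE /orP[]/eqP iE; subst => //.
- by rewrite ltnn in ij.
- by have := ltn_trans ij kl; rewrite ltnn.
- by rewrite ltnn in ij.
Qed.

Lemma hform2_pair chi i j : (i < j)%N -> hform2 chi [set i; j]%SET = chi i j.
Proof.
move=> ij; rewrite /hform2 sum_ffunE (bigD1 i)//= [X in _ + X]big1 ?addr0; last first.
  move=> k ki; rewrite sum_ffunE big1// => l kl.
  rewrite hwedge_hwedge_hscalar//; case: eqP => // /(set2_ltn_inj _ _ _ _ ij kl)[ik _].
  by rewrite ik eqxx in ki.
rewrite sum_ffunE (bigD1 j)//= hwedge_hwedge_hscalar// eqxx big1 ?addr0//.
move=> l /andP[il lj]; rewrite hwedge_hwedge_hscalar//.
case: eqP => // /(set2_ltn_inj _ _ _ _ ij il)[_ jl].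
by rewrite jl eqxx in lj.
Qed.

Lemma hdegree2_ext omega omega' : hdegree 2 omega -> hdegree 2 omega' ->
  (forall i j, (i < j)%N -> omega [set i; j]%SET = omega' [set i; j]%SET) ->
  omega = omega'.
Proof.
move=> om2 om'2 E; apply/ffunP => S.
have [S2|S2] := boolP (#|S| == 2%N); last by rewrite om2 ?om'2.
have /cards2P[x [y [xy ->]]] := S2.
have : (x < y)%N || (y < x)%N by rewrite -neq_ltn.
by case/orP => lt_xy; [exact: E|rewrite finset.setUC; exact: E].
Qed.

(** * The Hochschild-Kostant-Rosenberg map on generators *)

Section Evaluation.
Context (f : 'I_m -> A).
Local Notation var i := (mpoly.mpolyX R (mpoly.mnm1 i)).

Lemma peval_rmorphism : zmod_morphism (peval f) /\ monoid_morphism (peval f).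
Proof.
pose g : {rmorphism R -> A} := GRing.in_alg A.
split; first exact: (mpoly.mmap_is_additive f g).
have [? ?] := mpoly.mmap_is_multiplicative f g; split => //.
Qed.

Lemma inCM (a b : A) : inC f a -> inC f b -> inC f (a * b).
Proof.
by move=> [p ->] [q ->]; exists (p * q); rewrite peval_rmorphism.2.2.
Qed.

Lemma peval_var i : peval f (var i) = f i.
Proof.
rewrite /peval (mpoly.mmapX f (GRing.in_alg A)).
exact: mpoly.mmap1U.
Qed.

Lemma inC_gen i : inC f (f i).
Proof. by exists (var i); rewrite peval_var. Qed.

Lemma peval_mderiv_var i j :
  peval f (mpoly.mderiv i (var j)) = (i == j)%:R.
Proof.
have [pevalB [peval1 _]] := peval_rmorphism.
rewrite mpoly.mderivX mpoly.mnm1E (eq_sym j); case: eqP => [->|_].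
  have -> : mpoly.mnm_sub (mpoly.mnm1 j) (mpoly.mnm1 j) = mpoly.mnm0 :> mpoly.multinom m.
    by apply/mpoly.mnmP => k; rewrite mpoly.mnmBE subnn mpoly.mnm0E.
  by rewrite scale1r mpoly.mpolyX0.
by rewrite scale0r zmod_morphism0.
Qed.

Lemma hkr2_antisym omega p q : hkr2 f omega q p = - hkr2 f omega p q.
Proof.
rewrite /hkr2 -sumrN; apply: eq_bigr => i _; rewrite -sumrN; apply: eq_bigr => j _.
by rewrite -scalerN; congr (_ *: _); rewrite -[RHS]mulrN opprB.
Qed.

Lemma hkr2_var omega i j : (i < j)%N ->
  hkr2 f omega (var i) (var j) = 2^-1 *: omega [set i; j]%SET.
Proof.
move=> ij; rewrite /hkr2 (bigD1 i)//= [X in _ + X]big1 ?addr0; last first.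
  move=> k ki; rewrite big1// => l kl; rewrite !peval_mderiv_var.
  rewrite (negbTE ki) mul0r sub0r.
  case: eqP => [li|_]; last by rewrite mul0r oppr0 mulr0 scaler0.
  case: eqP => [kj|_]; last by rewrite mulr0 oppr0 mulr0 scaler0.
  by subst; have := ltn_trans ij kl; rewrite ltnn.
have neq_ltn_ord (k l : 'I_m) : (k < l)%N -> (k == l) = false.
  by move=> kl; apply/negbTE; rewrite -val_eqE neq_ltn kl.
rewrite (bigD1 j)//= big1 ?addr0 => [|l /andP[il lj]].
  by rewrite !peval_mderiv_var !eqxx (neq_ltn_ord i j)// mul0r subr0 !mulr1.
rewrite !peval_mderiv_var (negbTE lj) (eq_sym l) (neq_ltn_ord i l)// !mulr0.
by rewrite subrr mulr0 scaler0.
Qed.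

(** The coboundary of a 1-cochain is symmetric, the HKR cochain antisymmetric:
    antisymmetrising on a pair of generators extracts the coefficient of the
    form, the factor [1/2] of the HKR map being compensated by the two orders
    of the arguments. *)
Lemma hkr_class2_commutator (P : A -> A -> A) omega i j :
  hkr_class2 f P omega -> (i < j)%N ->
  P (f i) (f j) - P (f j) (f i) = omega [set i; j]%SET.
Proof.
case=> _ [phi _ E] ij; rewrite -(peval_var i) -(peval_var j) !E.
have -> a b : hochschild_d1 phi a b = hochschild_d1 phi b a.
  rewrite /hochschild_d1 (mulrC b a) (mulrC b) (mulrC (phi b)).
  by rewrite addrAC [RHS]addrAC [X in X - _]addrC.
rewrite opprD addrACA subrr addr0 (hkr2_antisym _ (var i)) opprK hkr2_var//.
by rewrite -scalerDl -div1r -splitr scale1r.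
Qed.
End Evaluation.

(** * The Garay-van Straten cochain is closed *)

Lemma d_hor0 (f : 'I_m -> A) br : (forall a, zmod_morphism (br a)) ->
  d_hor f br 0 = 0.
Proof.
move=> brB; rewrite /d_hor big1// => i _.
rewrite (_ : finfun _ = 0) ?raddf0//; apply/ffunP => S.
by rewrite !ffunE zmod_morphism0.
Qed.

(** The Jacobi identity of the star commutator for [F_i], [F_j], [F_k] at order
    [h^(n+1)]: as [[F_j, F_k]] starts at order [h^n], its commutator with [F_i]
    starts with [B_1 - B_1^op = 2 br] applied to leading terms. *)
Lemma d_hor_gvs_cochain (f : 'I_m -> A) (B : nat -> A -> A -> A) br n
    (F : 'I_m -> nat -> A) :
  (forall k : nat, biadditive (B k)) -> (forall a b, B 0%N a b = a * b) ->
  (forall F G H, star B (star B F G) H = star B F (star B G H)) ->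
  (forall a b, B 1%N a b = br a b) -> (forall a b, br a b = - br b a) ->
  commuting_lift f B n F -> d_hor f br (gvs_cochain B n F) = 0.
Proof.
move=> Badd B0 Bassoc B1 brC [F0 Fcomm]; apply: d_hor_hform2.
- by move=> a x y; rewrite -!B1 ((Badd 1%N).1 a).
- by move=> i j; rewrite /star_comm opprB.
move=> i j k; apply: (mulrn_Cinf_eq0 _ 1).
have C1 a b c : star_comm B (F a) (star_comm B (F b) (F c)) n.+1 =
    br (f a) (star_comm B (F b) (F c) n) *+ 2.
  rewrite star_comm_coef_order1//; last by move=> l; exact: Fcomm.
  by rewrite F0 !B1 [X in _ - X]brC opprK mulr2n.
have := congr1 (fun G => G n.+1) (star_comm_jacobi B (F i) (F j) (F k) Badd Bassoc).
by rewrite !fctE !C1 -!mulrnDl.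
Qed.

End RelativePoissonComplex.

Theorem proposition4 (R : realType) (d m : nat) (M : smooth_manifold R d)
  (br : Cinf M -> Cinf M -> Cinf M) (br_poisson : poisson_bracket br)
  (f : 'I_m -> Cinf M) (f_indep : submersion f)
  (f_comm : forall i j, br (f i) (f j) = 0)
  (B : nat -> Cinf M -> Cinf M -> Cinf M)
  (B_star : star_product B) (B_1 : forall a b, B 1%N a b = br a b)
  (n : nat) (n_ge2 : (2 <= n)%N)
  (D : nat -> Cinf M -> Cinf M) (D_diffop : formal_diffop D)
  (B'_vanish : forall k, (0 < k < n)%N -> forall a b, inC f a -> inC f b ->
     equivalent_star D B k a b = 0) :
  let B' := equivalent_star D B in
  let F := fun i => series_op D (series_cst (f i)) in
  (forall a b c, inC f a -> inC f b -> inC f c ->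
     hochschild_d2 (B' n) a b c = 0) /\
  commuting_lift f B n F /\
  d_hor f br (gvs_cochain B n F) = 0 /\
  (forall omega, hkr_class2 f (B' n) omega ->
     hcohomologous2 f br omega (gvs_cochain B n F)).
Proof.
move=> B' F; have [B0 Bloc Bassoc] := B_star.
have Badd k : biadditive (B k) by exact: bilinear2_biadditive (Bloc k).1.
have n_gt0 : (0 < n)%N by exact: ltnW.
have FC i j : divisible_by_power n (star_comm B (F i) (F j)) /\
    star_comm B (F i) (F j) n = B' n (f i) (f j) - B' n (f j) (f i).
  apply: star_comm_series_op => // k kn.
  by split; apply: B'_vanish => //; exact: inC_gen.
have Flift : commuting_lift f B n F.
  split=> [i|i j]; last exact: (FC i j).1.
  by rewrite /F /series_op big_ord1 D_diffop.1.
have dgvs : d_hor f br (gvs_cochain B n F) = 0.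
  exact: d_hor_gvs_cochain (poisson_antisym br_poisson) Flift.
split; first exact: equivalent_star_cocycle (@inCM _ _ _ _ f) B'_vanish.
split=> //; split=> // omega hom.
suff -> : omega = gvs_cochain B n F.
  split=> //; exists 0; first by move=> S _; rewrite ffunE.
  by rewrite subrr d_hor0// => a; exact: zmod_morphism_linear ((poisson_bilinear br_poisson).1 a).
apply: hdegree2_ext => [||i j ij]; [exact: hom.1|exact: hdegree2_hform2|].
by rewrite hform2_pair// (FC i j).2 (hkr_class2_commutator _ _ _ _ _ hom).
Qed.
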